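(* Let $N,M\ge1$, let $\mathcal{N}_k\subseteq\{1,\dots,N\}$ with $k\in\mathcal{N}_k$ be the neighborhood of node $k$, for $k=1,\dots,N$, and consider the problem of minimizing $$\mathrm{Tr}\big(\mathcal{A}^{\mathsf T}\mathcal{M}\mathcal{S}\mathcal{M}\mathcal{A}+\mathcal{R}_v^{(\psi)}\big)$$ over $N\times N$ matrices $A=[a_{lk}]$ subject to $A^{\mathsf T}\mathbf{1}_N=\mathbf{1}_N$, $a_{lk}\ge0$, and $a_{lk}=0$ if $l\notin\mathcal{N}_k$, where $\mathcal{A}=A\otimes I_M$ and $\mathcal{M},\mathcal{S},\mathcal{R}_v^{(\psi)}$ (the latter depending on $A$) are as defined in the context. The cost equals $$\sum_{k=1}^{N}\sum_{l\in\mathcal{N}_k}a_{lk}^2\big[\mu_l^2\sigma_{v,l}^2\mathrm{Tr}(R_{u,l})+\mathrm{Tr}(R_{v,lk}^{(\psi)})\big],$$ so the problem decouples into the $N$ separate problems, $k=1,\dots,N$, of minimizing $$\sum_{l\in\mathcal{N}_k}a_{lk}^2\big[\mu_l^2\sigma_{v,l}^2\mathrm{Tr}(R_{u,l})+\mathrm{Tr}(R_{v,lk}^{(\psi)})\big]$$ over $\{a_{lk},\,l\in\mathcal{N}_k\}$ subject to $\sum_{l\in\mathcal{N}_k}a_{lk}=1$, $a_{lk}\ge0$, and $a_{lk}=0$ if $l\notin\mathcal{N}_k$. With the nonnegative variance products $$\gamma_{lk}^2=\begin{cases}\mu_k^2\sigma_{v,k}^2\mathrm{Tr}(R_{u,k}),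 & l=k,\\ \mu_l^2\sigma_{v,l}^2\mathrm{Tr}(R_{u,l})+\mathrm{Tr}(R_{v,lk}^{(\psi)}), & l\in\mathcal{N}_k\setminus\{k\},\end{cases}$$ the solution is given by $$a_{lk}=\begin{cases}\dfrac{\gamma_{lk}^{-2}}{\sum_{m\in\mathcal{N}_k}\gamma_{mk}^{-2}}, & l\in\mathcal{N}_k,\\ 0, & \text{otherwise.}\end{cases}$$
   Context: Here $\mu_k>0$ are step-sizes, $\sigma_{v,k}^2$ are (model noise) variances, $R_{u,k}\ge0$ and $R_{v,lk}^{(\psi)}$ are $M\times M$ covariance matrices (of the regression data and of the link noise on the weight estimates sent from node $l$ to node $k$, respectively), with $R_{v,lk}^{(\psi)}=0$ if $l=k$ or $l\notin\mathcal{N}_k$. $\mathbf{1}_N$ is the all-ones vector of length $N$, $\otimes$ the Kronecker product and $\mathrm{Tr}$ the trace. Define $\mathcal{M}=\mathrm{diag}\{\mu_1I_M,\dots,\mu_NI_M\}$, $\mathcal{S}=\mathrm{diag}\{\sigma_{v,1}^2R_{u,1},\dots,\sigma_{v,N}^2R_{u,N}\}$ and $\mathcal{R}_v^{(\psi)}=\mathrm{diag}\{R_{v,1}^{(\psi)},\dots,R_{v,N}^{(\psi)}\}$ (block diagonal), where $R_{v,k}^{(\psi)}=\sum_{l\in\mathcal{N}_k\setminus\{k\}}a_{lk}^2R_{v,lk}^{(\psi)}$.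
   Formalization: The closed-form solution is asserted only when the variance products $\gamma_{lk}^2$ with $l\in\mathcal{N}_k$ are nonzero (for the node concerned, or for all nodes), since $\gamma_{lk}^{-2}$ is otherwise undefined. *)

(* Defs.v *)
From mathcomp Require Import all_boot all_order all_algebra.
From mathcomp.real_closed Require mxtens.

Set Implicit Arguments.
Unset Strict Implicit.
Unset Printing Implicit Defensive.

Import Order.TTheory GRing.Theory Num.Theory.
Local Open Scope ring_scope.
Local Open Scope sesquilinear_scope.

(* The data are allowed to be complex: [C] is a field such as the complex     *)
(* numbers.  Real scalars are elements of [C]: in the order of a              *)
(* [numClosedFieldType], [0 <= x] and [0 < x] imply that [x] is real.  A real *)
(* symmetric positive semidefinite matrix is in particular Hermitian positive *)
(* semidefinite, so that real data are included.                              *)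

Definition psdmx (C : numClosedFieldType) (n : nat) (S : 'M[C]_n) : Prop :=
  S \is hermsymmx /\ forall x : 'cV[C]_n, 0 <= (x ^t* *m S *m x) 0 0.

Definition minimizer (C : numClosedFieldType) (T : Type)
    (feasible : T -> Prop) (cost : T -> C) (x : T) : Prop :=
  feasible x /\ forall y, feasible y -> cost x <= cost y.

Lemma sum_block_size (N M : nat) : (\sum_(i < N) M = N * M)%N.
Proof. by rewrite sum_nat_const card_ord. Qed.

(* [\mxdiag_i B i] has size [\sum_(i < N) M]; the cast gives it the size of   *)
(* the Kronecker product of an N x N by an M x M matrix.                      *)
Definition blockdiag (C : numClosedFieldType) (N M : nat)
    (B : 'I_N -> 'M[C]_M) : 'M[C]_(N * M) :=
  castmx (sum_block_size N M, sum_block_size N M) (\mxdiag_(i < N) B i).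

Section Diffusion.

(* [nbr k] is the neighborhood of node k, [sigma2 k] the variance of the      *)
(* model noise at node k (already squared), and [Rv l k] the covariance of    *)
(* the noise on the link from l to k.                                         *)
Variables (C : numClosedFieldType) (N M : nat) (nbr : 'I_N -> {set 'I_N}).
Variables (mu sigma2 : 'I_N -> C) (Ru : 'I_N -> 'M[C]_M).
Variable Rv : 'I_N -> 'I_N -> 'M[C]_M.

Definition combine_mx (A : 'M[C]_N) : 'M[C]_(N * M) :=
  mxtens.tensmx A (1%:M : 'M[C]_M).

Definition step_mx : 'M[C]_(N * M) := blockdiag (fun k => (mu k)%:M).

Definition noise_mx : 'M[C]_(N * M) := blockdiag (fun k => sigma2 k *: Ru k).

Definition link_cov (A : 'M[C]_N) (k : 'I_N) : 'M[C]_M :=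
  \sum_(l in nbr k :\ k) A l k ^+ 2 *: Rv l k.

Definition link_mx (A : 'M[C]_N) : 'M[C]_(N * M) := blockdiag (link_cov A).

Definition total_cost (A : 'M[C]_N) : C :=
  \tr ((combine_mx A)^T *m step_mx *m noise_mx *m step_mx *m combine_mx A
       + link_mx A).

Definition feasible (A : 'M[C]_N) : Prop :=
  [/\ A^T *m const_mx 1 = const_mx 1 :> 'cV[C]_N,
      forall l k, 0 <= A l k
    & forall l k, l \notin nbr k -> A l k = 0].

(* The unknowns [a_lk], for l in the neighborhood of k, are the entries of a  *)
(* column vector whose other entries are required to vanish.                  *)
Definition node_cost (k : 'I_N) (a : 'cV[C]_N) : C :=
  \sum_(l in nbr k)
    a l 0 ^+ 2 * (mu l ^+ 2 * sigma2 l * \tr (Ru l) + \tr (Rv l k)).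

Definition node_feasible (k : 'I_N) (a : 'cV[C]_N) : Prop :=
  [/\ \sum_(l in nbr k) a l 0 = 1,
      forall l, 0 <= a l 0
    & forall l, l \notin nbr k -> a l 0 = 0].

(* The variance product, already squared; only meaningful for l in [nbr k].   *)
Definition gamma2 (l k : 'I_N) : C :=
  if l == k then mu k ^+ 2 * sigma2 k * \tr (Ru k)
  else mu l ^+ 2 * sigma2 l * \tr (Ru l) + \tr (Rv l k).

Definition relative_variance : 'M[C]_N :=
  \matrix_(l, k)
    (if l \in nbr k
     then (gamma2 l k)^-1 / \sum_(m in nbr k) (gamma2 m k)^-1
     else 0).

End Diffusion.

(* Main.v *)
Require Import Defs.
From mathcomp Require Import all_boot all_order all_algebra.
From mathcomp Require Import ring.
From mathcomp.real_closed Require Import mxtens.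
Import Order.TTheory GRing.Theory Num.Theory.
Local Open Scope ring_scope.

(** The block diagonal matrix with blocks [B i] is the sum of the Kronecker
    products [E_ii (x) B i], so the mixed product rule and
    [tr (X (x) Y) = tr X * tr Y] evaluate the cost entrywise.  The feasible set
    is a product over the columns of [A] and the cost is a sum over them, which
    decouples the nodes.  At each node, with weights [w l > 0] and
    [b l = (w l)^-1 / S] where [S] is the sum of the [(w l)^-1], every [a] of
    total mass one satisfies
    [sum w a^2 = S^-1 + sum w (a - b)^2]. *)

(** * Kronecker products and block diagonal matrices *)

Lemma mxtrace_tens (R : pzRingType) (m n : nat) (A : 'M[R]_m) (B : 'M[R]_n) :
  \tr (tensmx A B) = \tr A * \tr B.
Proof. by rewrite /mxtrace mulr_sum; apply: eq_bigr => i _; rewrite mxE. Qed.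

(** Both indexings are row-major: since all blocks have size [M], the sizes of the blocks before
    block [i] add up to [i * M]. *)
Lemma cast_mxtens_index (N M : nat) (i : 'I_N) (p : 'I_M) :
  cast_ord (esym (sum_block_size N M)) (mxtens_index (i, p)) =
  @tagnat.Rank N (fun=> M) i p.
Proof.
apply: val_inj; rewrite [RHS]tagnat.RankEsum /=.
by rewrite -(big_ord_widen N (fun=> M) (ltnW (ltn_ord i))) sum_nat_const card_ord.
Qed.

Lemma blockdiag_tens (C : numClosedFieldType) (N M : nat)
    (B : 'I_N -> 'M[C]_M) :
  blockdiag B = \sum_i tensmx (delta_mx i i) (B i).
Proof.
apply/matrixP => u v; case: (mxtens_indexP u) => i p.
case: (mxtens_indexP v) => j q.
rewrite castmxE /= !cast_mxtens_index.
(* Passing through the block at [(i, j)] lets [mxblockK] read it off. *)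
transitivity (submxblock (\mxdiag_i B i) i j p q); first by rewrite !mxE.
rewrite mxblockK summxE.
under eq_bigr do rewrite tensmxE mxE.
rewrite (bigD1 i) //= eqxx big1 => [|k ki]; last first.
  by rewrite [i == k]eq_sym (negPf ki) mul0r.
rewrite addr0; case: eqVneq => _.
  by rewrite conform_mx_id mul1r.
by rewrite mul0r mxE.
Qed.

Lemma blockdiag_mul (C : numClosedFieldType) (N M : nat)
    (B D : 'I_N -> 'M[C]_M) :
  blockdiag B *m blockdiag D = blockdiag (fun i => B i *m D i).
Proof.
rewrite !blockdiag_tens mulmx_suml; apply: eq_bigr => i _.
rewrite mulmx_sumr (bigD1 i) //= big1 => [|j ji].
  by rewrite addr0 tensmx_mul mul_delta_mx.
by rewrite tensmx_mul mul_delta_mx_0 ?tens0mx // eq_sym.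
Qed.

Lemma mxtrace_blockdiag (C : numClosedFieldType) (N M : nat)
    (B : 'I_N -> 'M[C]_M) : \tr (blockdiag B) = \sum_i \tr (B i).
Proof.
rewrite blockdiag_tens raddf_sum; apply: eq_bigr => i _.
rewrite /= mxtrace_tens /mxtrace (bigD1 i) //= mxE eqxx big1 ?addr0 ?mul1r //.
by move=> j /negPf ji; rewrite mxE ji.
Qed.

(** The matrix is the outer product of row [i] of [A] with itself, so its diagonal entries are the
    squares of that row. *)
Lemma mxtrace_congr_delta (R : comPzRingType) (n : nat) (A : 'M[R]_n) (i : 'I_n) :
  \tr (A^T *m delta_mx i i *m A) = \sum_k A i k ^+ 2.
Proof.
apply: eq_bigr => k _; rewrite -mulmxA mxE (bigD1 i) //= big1 => [|j ji].
  rewrite addr0 !mxE (bigD1 i) //= big1 => [|l li]; last first.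
    by rewrite mxE (negPf li) andbF mul0r.
  by rewrite mxE !eqxx mul1r addr0 expr2.
by rewrite [X in _ * X]mxE big1 ?mulr0 // => l _; rewrite mxE (negPf ji) mul0r.
Qed.

Lemma mxtrace_psd_ge0 (C : numClosedFieldType) (n : nat) (S : 'M[C]_n) :
  psdmx S -> 0 <= \tr S.
Proof.
case=> _ psdS; apply: sumr_ge0 => i _.
(* The quadratic form at a basis vector is a diagonal entry. *)
have := psdS (delta_mx i 0).
by rewrite trmx_delta map_delta_mx -rowE -colE !mxE.
Qed.

(** * Weighted least squares on the simplex *)

Section WeightedSquares.

Variables (C : numFieldType) (I : finType) (P : {pred I}) (w : I -> C).
Hypothesis w_gt0 : forall l, P l -> 0 < w l.
Let S := \sum_(l | P l) (w l)^-1.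

Lemma sum_inv_weights_gt0 (k : I) : P k -> 0 < S.
Proof.
move=> Pk; rewrite /S (bigD1 k) //= ltr_pwDl ?invr_gt0 ?w_gt0 //.
by apply: sumr_ge0 => l /andP[Pl _]; rewrite invr_ge0 ltW ?w_gt0.
Qed.

(** Completing the square: the cross term of each summand is [a l] times a constant independent of
    [l], so the constraint fixes the sum of the cross terms to [2 / S]. The constant terms sum to
    [S / S ^+ 2]. *)
Lemma sum_weighted_squares (a : I -> C) : S != 0 ->
  \sum_(l | P l) a l = 1 ->
  \sum_(l | P l) a l ^+ 2 * w l =
    S^-1 + \sum_(l | P l) (a l - (w l)^-1 / S) ^+ 2 * w l.
Proof.
move=> S0 sa.
have -> : \sum_(l | P l) (a l - (w l)^-1 / S) ^+ 2 * w l =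
    \sum_(l | P l) (a l ^+ 2 * w l - a l * (2 / S) + (w l)^-1 * (S^-1) ^+ 2).
  apply: eq_bigr => l /w_gt0 /gt_eqF /negbT wl0.
  by field; apply/andP.
rewrite big_split /= sumrB -!mulr_suml sa -/S.
by field.
Qed.

End WeightedSquares.

(** * Decoupling *)

(** The identity factor of [combine_mx] leaves each [D l] untouched, so only [A] meets the diagonal
    unit matrices. *)
Lemma mxtrace_tens_congr_blockdiag (C : numClosedFieldType) (N M : nat)
    (A : 'M[C]_N) (D : 'I_N -> 'M[C]_M) :
  \tr ((combine_mx M A)^T *m blockdiag D *m combine_mx M A) =
  \sum_k \sum_l A l k ^+ 2 * \tr (D l).
Proof.
rewrite exchange_big blockdiag_tens mulmx_sumr mulmx_suml raddf_sum /=.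
apply: eq_bigr => l _; rewrite /combine_mx trmx_tens !tensmx_mul mxtrace_tens.
by rewrite mxtrace_congr_delta trmx1 mul1mx mulmx1 mulr_suml.
Qed.

Lemma step_noise_step (C : numClosedFieldType) (N M : nat) (mu sigma2 : 'I_N -> C)
    (Ru : 'I_N -> 'M[C]_M) :
  step_mx M mu *m noise_mx sigma2 Ru *m step_mx M mu =
  blockdiag (fun l => (mu l ^+ 2 * sigma2 l) *: Ru l).
Proof.
rewrite /step_mx /noise_mx !blockdiag_mul; congr castmx; apply/eq_mxdiagP => l.
rewrite mul_scalar_mx mul_mx_scalar !scalerA; congr (_ *: _); ring.
Qed.

Lemma total_costE (C : numClosedFieldType) (N M : nat)
    (nbr : 'I_N -> {set 'I_N}) (mu sigma2 : 'I_N -> C) (Ru : 'I_N -> 'M[C]_M)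
    (Rv : 'I_N -> 'I_N -> 'M[C]_M) (A : 'M[C]_N) :
  (forall k, Rv k k = 0) -> feasible nbr A ->
  total_cost nbr mu sigma2 Ru Rv A =
  \sum_k node_cost nbr mu sigma2 Ru Rv k (col k A).
Proof.
move=> Rv0 [_ _ A0].
rewrite /total_cost mxtraceD mxtrace_blockdiag -2!(mulmxA (combine_mx M A)^T).
rewrite step_noise_step mxtrace_tens_congr_blockdiag -big_split /=.
apply: eq_bigr => k _; rewrite /node_cost /link_cov raddf_sum /=.
(* The data term ranges over all nodes; feasibility kills the weights outside the neighborhood. *)
rewrite (bigID [in nbr k]) /= [X in _ + X + _]big1 => [|l /A0 ->]; last first.
  by rewrite expr0n mul0r.
(* The link term omits [l = k]; it can be put back because [Rv k k = 0]. *)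
rewrite addr0 (_ : \sum_(l in nbr k :\ k) _ =
    \sum_(l in nbr k) \tr (A l k ^+ 2 *: Rv l k)).
  rewrite -big_split; apply: eq_bigr => l _ /=.
  by rewrite !mxE !mxtraceZ mulrDr.
rewrite [RHS](bigID (pred1 k)) /= [X in _ = X + _]big1 => [|l /andP[_ /eqP->]].
  by rewrite add0r; apply: eq_bigl => l; rewrite !inE andbC.
by rewrite Rv0 scaler0 mxtrace0.
Qed.

Lemma feasible_node_feasible (C : numClosedFieldType) (N : nat)
    (nbr : 'I_N -> {set 'I_N}) (A : 'M[C]_N) :
  feasible nbr A <-> forall k, node_feasible nbr k (col k A).
Proof.
have colsum k : (forall l, l \notin nbr k -> A l k = 0) ->
    (A^T *m const_mx 1 : 'cV_N) k 0 = \sum_(l in nbr k) col k A l 0.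
  move=> A0; rewrite mxE (bigID [in nbr k]) /= [X in _ + X]big1 => [|l /A0 Al].
    by rewrite addr0; apply: eq_bigr => l _; rewrite !mxE mulr1.
  by rewrite mxE Al mul0r.
split=> [[A1 Age0 A0] k|nodeA].
  split=> [|l|l /A0 Al]; rewrite ?mxE //.
  by rewrite -colsum ?A1 ?mxE // => l; apply: A0.
have A0 l k : l \notin nbr k -> A l k = 0.
  by have [_ _ /(_ l)] := nodeA k; rewrite mxE.
split=> // [|l k]; last by have [_ /(_ l)] := nodeA k; rewrite mxE.
apply/matrixP => k j; rewrite ord1 colsum => [|l]; last exact: A0.
by have [-> _ _] := nodeA k; rewrite mxE.
Qed.

(* If column [k] of [A] is not optimal, replacing it alone improves [A]. *)
Lemma minimizer_columns (C : numClosedFieldType) (N : nat)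
    (feas : 'M[C]_N -> Prop) (cost : 'M[C]_N -> C)
    (nfeas : 'I_N -> 'cV[C]_N -> Prop) (ncost : 'I_N -> 'cV[C]_N -> C)
    (A : 'M[C]_N) :
  (forall B, feas B <-> forall k, nfeas k (col k B)) ->
  (forall B, feas B -> cost B = \sum_k ncost k (col k B)) ->
  minimizer feas cost A <->
  forall k, minimizer (nfeas k) (ncost k) (col k A).
Proof.
move=> feasE costE; split=> [[fA minA] k|minA]; last first.
  have fA : feas A by apply/feasE => k; case: (minA k).
  split=> // B fB; rewrite !costE //; apply: ler_sum => k _.
  by case: (minA k) => _; apply; apply: (feasE B).1.
have nfA := (feasE A).1 fA; split=> // y fy.
pose B := \matrix_(i, j) (if j == k then y i 0 else A i j).
have colB j : col j B = if j == k then y else col j A.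
  apply/matrixP => i z; rewrite ord1 !mxE.
  by case: eqVneq => // _; rewrite mxE.
have fB : feas B by apply/feasE => j; rewrite colB; case: eqVneq => [->|].
(* [A] and [B] share all columns but [k], so the other terms cancel from the inequality. *)
have := minA B fB; rewrite !costE // (bigD1 k) //= [leRHS](bigD1 k) //= colB eqxx.
rewrite [X in _ <= _ + X](eq_bigr (fun j => ncost j (col j A))) ?lerD2r //.
by move=> j /negPf jk; rewrite colB jk.
Qed.

(** * The relative-variance rule at one node *)

Lemma gamma2E (C : numClosedFieldType) (N M : nat) (mu sigma2 : 'I_N -> C)
    (Ru : 'I_N -> 'M[C]_M) (Rv : 'I_N -> 'I_N -> 'M[C]_M) (l k : 'I_N) :
  Rv k k = 0 ->
  gamma2 mu sigma2 Ru Rv l k =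
  mu l ^+ 2 * sigma2 l * \tr (Ru l) + \tr (Rv l k).
Proof. by rewrite /gamma2; case: eqVneq => // -> ->; rewrite mxtrace0 addr0. Qed.

Lemma node_minimizerP (C : numClosedFieldType) (N M : nat)
    (nbr : 'I_N -> {set 'I_N}) (mu sigma2 : 'I_N -> C) (Ru : 'I_N -> 'M[C]_M)
    (Rv : 'I_N -> 'I_N -> 'M[C]_M) (k : 'I_N) (a : 'cV[C]_N) :
  Rv k k = 0 -> k \in nbr k ->
  (forall l, l \in nbr k -> 0 < gamma2 mu sigma2 Ru Rv l k) ->
  minimizer (node_feasible nbr k) (node_cost nbr mu sigma2 Ru Rv k) a <->
  a = col k (relative_variance nbr mu sigma2 Ru Rv).
Proof.
move=> Rv0 kk w_gt0; set w := fun l => gamma2 mu sigma2 Ru Rv l k.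
set b := col k _; set S := \sum_(l in nbr k) (w l)^-1.
(* The neighborhood is nonempty, as it contains [k]. *)
have S_gt0 : 0 < S by apply: sum_inv_weights_gt0 kk.
have S0 : S != 0 by rewrite gt_eqF.
have bE l : l \in nbr k -> b l 0 = (w l)^-1 / S by move=> lk; rewrite !mxE lk.
have b0 l : l \notin nbr k -> b l 0 = 0 by rewrite !mxE => /negPf ->.
have b_ge0 l : 0 <= b l 0.
  have [lk|/b0 -> //] := boolP (l \in nbr k).
  by rewrite bE // mulr_ge0 ?invr_ge0 ?(ltW S_gt0) ?(ltW (w_gt0 _ lk)).
have fb : node_feasible nbr k b.
  by split=> //; rewrite (eq_bigr _ bE) -mulr_suml divff.
have costE c : node_feasible nbr k c ->
    node_cost nbr mu sigma2 Ru Rv k c =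
    S^-1 + \sum_(l in nbr k) (c l 0 - b l 0) ^+ 2 * w l.
  case=> sc _ _; rewrite (eq_bigr (fun l => (c l 0 - (w l)^-1 / S) ^+ 2 * w l)).
    rewrite -sum_weighted_squares //.
    by apply: eq_bigr => l _; rewrite /w gamma2E.
  by move=> l /bE ->.
have term_ge0 c l : node_feasible nbr k c -> l \in nbr k ->
    0 <= (c l 0 - b l 0) ^+ 2 * w l.
  move=> [_ c_ge0 _] lk; rewrite mulr_ge0 ?(ltW (w_gt0 _ lk)) //.
  (* Squares in [C] need not be nonnegative; here both weights are nonnegative, so their difference
     is real. *)
  by rewrite real_exprn_even_ge0 // rpredB // ger0_real.
have costb : node_cost nbr mu sigma2 Ru Rv k b = S^-1.
  by rewrite costE // big1 ?addr0 // => l _; rewrite subrr expr0n mul0r.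
split=> [[fa mina]|->]; last first.
  split=> // c fc; rewrite costb costE // lerDl.
  by apply: sumr_ge0 => l; apply: term_ge0.
(* Uniqueness: the excess of the cost of [a] over that of [b] is a sum of nonnegative terms that is
   at most zero, and positive weights force [a] and [b] to agree on the neighborhood. *)
have := mina b fb; rewrite costb costE // gerDl => le0.
have /eqP : \sum_(l in nbr k) (a l 0 - b l 0) ^+ 2 * w l = 0.
  by apply/le_anti; rewrite le0 sumr_ge0 // => l; apply: term_ge0.
rewrite psumr_eq0 => [/allP z|l]; last exact: term_ge0.
apply/matrixP => l j; rewrite ord1.
have [lk|lk] := boolP (l \in nbr k); last by rewrite b0 //; case: fa => _ _ ->.
have := z l (mem_index_enum l); rewrite lk /= mulf_eq0 (gt_eqF (w_gt0 _ lk)) orbF.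
by rewrite expf_eq0 /= subr_eq0 => /eqP.
Qed.

Theorem mainTheorem2 (C : numClosedFieldType) (N M : nat)
    (hN : (1 <= N)%N) (hM : (1 <= M)%N)
    (nbr : 'I_N -> {set 'I_N}) (hnbr : forall k, k \in nbr k)
    (mu : 'I_N -> C) (hmu : forall k, 0 < mu k)
    (sigma2 : 'I_N -> C) (hsigma2 : forall k, 0 <= sigma2 k)
    (Ru : 'I_N -> 'M[C]_M) (hRu : forall k, psdmx (Ru k))
    (Rv : 'I_N -> 'I_N -> 'M[C]_M) (hRv : forall l k, psdmx (Rv l k))
    (hRv0 : forall l k, (l == k) || (l \notin nbr k) -> Rv l k = 0) :
  (* the cost on the feasible set *)
  (forall A : 'M[C]_N, feasible nbr A ->
     total_cost nbr mu sigma2 Ru Rv A =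
       \sum_(k < N) \sum_(l in nbr k)
         A l k ^+ 2 * (mu l ^+ 2 * sigma2 l * \tr (Ru l) + \tr (Rv l k))) /\
  (* decoupling of the feasible set and of the minimizers *)
  (forall A : 'M[C]_N,
     feasible nbr A <-> forall k, node_feasible nbr k (col k A)) /\
  (forall A : 'M[C]_N,
     minimizer (feasible nbr) (total_cost nbr mu sigma2 Ru Rv) A <->
     forall k, minimizer (node_feasible nbr k)
                 (node_cost nbr mu sigma2 Ru Rv k) (col k A)) /\
  (* nonnegativity of the variance products *)
  (forall k l, l \in nbr k -> 0 <= gamma2 mu sigma2 Ru Rv l k) /\
  (* the solution of each node's problem, where its formula makes sense *)
  (forall k, (forall l, l \in nbr k -> gamma2 mu sigma2 Ru Rv l k != 0) ->
     forall a : 'cV[C]_N,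
       minimizer (node_feasible nbr k) (node_cost nbr mu sigma2 Ru Rv k) a <->
       a = col k (relative_variance nbr mu sigma2 Ru Rv)) /\
  (* the solution of the whole problem *)
  ((forall k l, l \in nbr k -> gamma2 mu sigma2 Ru Rv l k != 0) ->
     forall A : 'M[C]_N,
       minimizer (feasible nbr) (total_cost nbr mu sigma2 Ru Rv) A <->
       A = relative_variance nbr mu sigma2 Ru Rv).
Proof.
have Rv0 k : Rv k k = 0 by rewrite hRv0 ?eqxx.
have costE A : feasible nbr A -> total_cost nbr mu sigma2 Ru Rv A =
    \sum_k node_cost nbr mu sigma2 Ru Rv k (col k A) by exact: total_costE.
have minE A : minimizer (feasible nbr) (total_cost nbr mu sigma2 Ru Rv) A <->
    forall k, minimizer (node_feasible nbr k)
                (node_cost nbr mu sigma2 Ru Rv k) (col k A).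
  by apply: minimizer_columns costE => B; apply: feasible_node_feasible.
have g_ge0 l k : 0 <= gamma2 mu sigma2 Ru Rv l k.
  rewrite gamma2E // addr_ge0 ?mxtrace_psd_ge0 //.
  by rewrite !mulr_ge0 ?mxtrace_psd_ge0 // ltW.
have nodeP k : (forall l, l \in nbr k -> gamma2 mu sigma2 Ru Rv l k != 0) ->
    forall a : 'cV[C]_N,
      minimizer (node_feasible nbr k) (node_cost nbr mu sigma2 Ru Rv k) a <->
      a = col k (relative_variance nbr mu sigma2 Ru Rv).
  move=> g0 a; apply: node_minimizerP => // l /g0 gl.
  (* A nonnegative variance product that is nonzero is positive. *)
  by rewrite lt0r gl g_ge0.
split=> [A fA|].
  rewrite costE //; apply: eq_bigr => k _; apply: eq_bigr => l _.
  by rewrite mxE.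
split=> [A|]; first exact: feasible_node_feasible.
(* Only the global solution remains; it is assembled column by column from [nodeP]. *)
do 3![split=> //] => g0 A; apply: (iff_trans (minE A)); split=> [minA|-> k].
  apply/matrixP => l k.
  have /(nodeP k (g0 k)) /matrixP /(_ l 0) := minA k.
  by rewrite [LHS]mxE [RHS]mxE.
by apply/nodeP => //; apply: g0.
Qed.
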